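(* Let $(X,d_X)$ be a complete separable metric space with a fixed reference point $x_*\in X$, let $p\ge 1$, and let $L:X\to[0,1]$ be uniformly continuous on bounded sets. Let $\mathfrak C\subset\mathcal P_p(X)$ be a class of priors such that $\lim_{R\to\infty}\tau_{\mathfrak C,p}(R)=0$ and $\inf_{\mu\in\mathfrak C}\mu(L)\ge\zeta>0$. Then the prior-to-posterior map $\mathcal B_L:(\mathfrak C,W_p)\to(\mathcal P_p(X),W_p)$ is uniformly continuous.
   Context: $\mathcal P(X)$ is the set of Borel probability measures on $X$, and $\mathcal P_p(X)$ is the set of $\mu\in\mathcal P(X)$ with $m_p(\mu):=\int_X d_X(x,x_* )^p\,\mu(\mathrm dx)<\infty$. For $\mu,\nu\in\mathcal P_p(X)$, $W_p(\mu,\nu):=\left(\inf_{\pi\in\Pi(\mu,\nu)}\int_{X\times X}d_X(x,x')^p\,\pi(\mathrm dx,\mathrm dx')\right)^{1/p}$, where $\Pi(\mu,\nu)$ is the set of couplings of $\mu$ and $\nu$. For measurable $L:X\to[0,\infty)$ (the likelihood) write $\mu(L):=\int_X L\,\mathrm d\mu$. If $0<\mu(L)<\infty$, the posterior is the probability measure $\mathcal B_L(\mu)(\mathrm dx):=\mu(L)^{-1}L(x)\,\mu(\mathrm dx)$. With $B_X(R):=\{x\in X: d_X(x,x_* )\le R\}$, a function on $X$ is uniformly continuous on bounded sets if its restriction to $B_X(R)$ is uniformly continuous for every $R>0$. The moment-tail function of a class $\mathfrak C\subset\mathcal P_p(X)$ is $\tau_{\mathfrak C,p}(R):=\sup_{\mu\in\mathfrak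 C}\int_{\{d_X(x,x_* )>R\}}d_X(x,x_* )^p\,\mu(\mathrm dx)$. *)

(* Defs.v *)
From HB Require Import structures.
From mathcomp Require Import all_boot all_order all_algebra.
From mathcomp Require Import all_classical all_reals all_analysis measurable_realfun.

Set Implicit Arguments.
Unset Strict Implicit.
Unset Printing Implicit Defensive.

Import Order.TTheory GRing.Theory Num.Theory.
Import numFieldNormedType.Exports.

Local Open Scope classical_set_scope.
Local Open Scope ring_scope.
Local Open Scope ereal_scope.

#[short(type="completeMetricType")]
HB.structure Definition CompleteMetric (R : numDomainType) :=
  {T of CompletePseudoMetric R T & Metric R T}.

Definition separable (X : topologicalType) : Prop :=
  exists2 D : set X, countable D & dense D.

Definition borel (X : ptopologicalType) := g_sigma_algebraType (@open X).

Section bounded_sets.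
Context {R : realType} {X : metricType R}.

Definition bounded_ball (xstar : X) (r : R) : set X :=
  [set x | (mdist x xstar <= r)%R].

Definition unif_continuous_on_bounded (xstar : X) (f : X -> R) : Prop :=
  forall r : R, (0 < r)%R ->
    unif_continuous (fun x : set_type (bounded_ball xstar r) => f (set_val x)).

Lemma unif_continuous_on_boundedP (xstar : X) (f : X -> R) :
  unif_continuous_on_bounded xstar f <->
  forall r : R, (0 < r)%R -> forall e : R, (0 < e)%R ->
    exists2 d : R, (0 < d)%R & forall x y : X,
      bounded_ball xstar r x -> bounded_ball xstar r y ->
      (mdist x y < d)%R -> (`|f x - f y| < e)%R.
Proof.
split=> ucf r r0.
- move=> e e0; have /unif_continuousP /(_ e e0)[d /= d0 H] := ucf r r0.
  exists d => // x y bx b_y xy.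
  have := H (exist _ x (mem_set bx), exist _ y (mem_set b_y)).
  rewrite /= !set_valE /=; apply.
  by have : ball x d y by rewrite ballEmdist.
- apply/unif_continuousP => e e0; have [d d0 H] := ucf r r0 e e0.
  exists d => //= -[[x bx] [y b_y]]/= xy.
  have {xy} : ball x d y by move: xy; rewrite /= /ball/= set_valE.
  rewrite ballEmdist /= !set_valE /= => xy.
  by apply: H => //; exact: set_mem.
Qed.

End bounded_sets.

Section wasserstein.
Context {R : realType} {X : completeMetricType R}.
Implicit Types (xstar : X) (p : R) (mu nu : probability (borel X) R).

Definition moment xstar p mu : \bar R :=
  \int[mu]_x ((mdist (x : X) xstar `^ p)%R)%:E.

Definition finite_moment xstar p : set (probability (borel X) R) :=
  [set mu | moment xstar p mu < +oo].

(* Marginals are compared on Borel sets only: the values of a measure on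
   non-measurable sets are unconstrained.  For a separable X the product
   sigma-algebra on X * X is the Borel one. *)
Definition couplings mu nu : set (probability (borel X * borel X)%type R) :=
  [set pi | forall A : set (borel X), measurable A ->
     pushforward pi fst A = mu A /\ pushforward pi snd A = nu A].

Definition wasserstein p mu nu : \bar R :=
  (ereal_inf [set \int[pi]_z ((mdist (z.1 : X) (z.2 : X) `^ p)%R)%:E
             | pi in couplings mu nu]) `^ (p^-1)%R.

Definition moment_tail xstar p (C : set (probability (borel X) R)) (r : R)
    : \bar R :=
  ereal_sup [set \int[mu]_(x in [set x : borel X | (r < mdist (x : X) xstar)%R])
                   ((mdist (x : X) xstar `^ p)%R)%:E | mu in C].

Definition evidence (L : X -> R) mu : \bar R := \int[mu]_x (L x)%:E.

End wasserstein.

Section likelihood_measure.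
Context {R : realType} {X : completeMetricType R}.
Variables (L : X -> R) (mu : probability (borel X) R).
Hypothesis mL : measurable_fun [set: borel X] (L : borel X -> R).
Hypothesis L0 : forall x, (0 <= L x)%R.

Definition likelihood_measure of measurable_fun [set: borel X] (L : borel X -> R)
    & (forall x, (0 <= L x)%R) :=
  fun A : set (borel X) => \int[mu]_(x in A) (L x)%:E.

Local Notation nu := (likelihood_measure mL L0).

Let nu0 : nu set0 = 0.
Proof. exact: integral_set0. Qed.

Let nu_ge0 A : 0 <= nu A.
Proof. by apply: integral_ge0 => x _; rewrite lee_fin. Qed.

Let nu_sigma_additive : semi_sigma_additive nu.
Proof.
apply: semi_sigma_additive_nng_induced; first exact/measurable_EFinP.
by move=> x; rewrite lee_fin.
Qed.

HB.instance Definition _ :=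
  isMeasure.Build _ _ _ nu nu0 nu_ge0 nu_sigma_additive.

End likelihood_measure.

Section posterior.
Context {R : realType} {X : completeMetricType R}.
Implicit Types (L : X -> R) (mu : probability (borel X) R).

(* L(x) mu(dx) / mu(L), made total by the junk value mu when L is not
   a measurable nonnegative function or mu(L) is 0 or +oo; see posteriorE. *)
Definition posterior L mu : probability (borel X) R :=
  match pselect (measurable_fun [set: borel X] (L : borel X -> R) /\
                 forall x, (0 <= L x)%R) with
  | left LP => mnormalize (likelihood_measure mu LP.1 LP.2) mu
  | right _ => mu
  end.

Lemma posteriorE L mu (A : set (borel X)) :
  measurable_fun [set: borel X] (L : borel X -> R) ->
  (forall x, (0 <= L x)%R) ->
  0 < evidence L mu < +oo ->
  posterior L mu A =
  ((fine (evidence L mu))^-1)%:E * \int[mu]_(x in A) (L x)%:E.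
Proof.
move=> mL L0 /andP[ev0 evoo]; rewrite /posterior.
case: pselect => [LP|/(_ (conj mL L0))//].
rewrite /= /mnormalize /= /likelihood_measure -/(evidence L mu).
by rewrite (gt_eqF ev0) (lt_eqF evoo) /= muleC.
Qed.

End posterior.

(* Main.v *)
From HB Require Import structures.
Require Import Defs.
From mathcomp Require Import all_boot all_order all_algebra.
From mathcomp Require Import all_classical all_reals all_analysis measurable_realfun.
From mathcomp Require Import ring lra.
Set Implicit Arguments.
Unset Strict Implicit.
Unset Printing Implicit Defensive.
Import Order.TTheory GRing.Theory Num.Theory.
Import numFieldNormedType.Exports.
Import HBNNSimple.
Local Open Scope classical_set_scope.
Local Open Scope ring_scope.
Local Open Scope ereal_scope.

(** Posteriors are compared by turning a coupling [pi] of the priors [mu] and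
    [nu] into a coupling of the posteriors.  Write [a = L / mu(L)] and
    [b = L / nu(L)] for the two posterior densities.  On the mass that the
    densities share at a pair [(x, y)], namely [min (a x) (b y)], the plan [pi]
    is kept, so that this part costs at most [zeta^-1] times the cost of [pi].
    The two leftover measures, with densities [a x - min (a x) (b y)] and
    [b y - min (a x) (b y)] with respect to [pi], have the same mass and are
    coupled by their normalized product ([overlap_coupling]).  Since
    [d(x, y)^p <= 2^p (d(x, xstar)^p + d(y, xstar)^p)], the cost of the leftover
    part is bounded by the p-th moments of its two marginals.

    These moments are small for two reasons.  Inside the ball of radius [r]
    the moment weight is at most [r^p], and the leftover density is controlled
    by [|L x - L y|] and by [|mu(L) - nu(L)|], which is itself at most the
    [pi]-integral of [|L x - L y|].  Outside that ball the leftover density is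
    at most [zeta^-1] and the moment tail of the class takes over.  This is
    [posterior_coupling_cost].

    It remains to make the [pi]-integral of [|L x - L y|] small uniformly over
    the class ([likelihood_gap]): the integrand is at most 1; it is small for
    close points of a large ball by uniform continuity; pairs leaving the ball
    are charged to the moment tail, and distant pairs to the transport cost by
    Markov's inequality.  The radius [r] is chosen first, from the tails, then
    the bound on the likelihood gap, then the transport cost allowed between
    the priors.

    Separability makes the distance measurable for the product sigma-algebra
    ([measurable_mdist]). *)

(** * Measures with a density *)

(** Existential form of the measure [f mu]: the change of variables is obtained
    for all nonnegative measurable [g] by monotone approximation with simple
    functions. *)
Lemma density_measure d (T : measurableType d) (R : realType)
    (mu : {measure set T -> \bar R}) (f : T -> R) :
  measurable_fun [set: T] f -> (forall x, (0 <= f x)%R) ->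
  exists nu : {measure set T -> \bar R},
    (forall A, measurable A -> nu A = \int[mu]_(x in A) (f x)%:E) /\
    (forall g : T -> \bar R,
       measurable_fun [set: T] g -> (forall x, 0 <= g x) ->
       \int[nu]_x g x = \int[mu]_x (g x * (f x)%:E)).
Proof.
move=> mf f0.
have mfE : measurable_fun [set: T] (EFin \o f) by exact/measurable_EFinP.
have f0E x : 0 <= (EFin \o f) x by rewrite lee_fin.
pose w (A : set T) := \int[mu]_(x in A) (EFin \o f) x.
have w0 : w set0 = 0 by exact: integral_set0.
have w_ge0 A : 0 <= w A by apply: integral_ge0.
have w_sadd : semi_sigma_additive w by exact: semi_sigma_additive_nng_induced.
pose nu : {measure set T -> \bar R} :=
  HB.pack w (isMeasure.Build d T R w w0 w_ge0 w_sadd).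
exists nu; split=> // g mg g0.
pose h := nnsfun_approx measurableT mg.
have hg x : (EFin \o h n) x @[n --> \oo] --> g x.
  by apply: cvg_nnsfun_approx => // ? _.
have hgf x : ((h n x)%:E * (f x)%:E) @[n --> \oo] --> g x * (f x)%:E.
  by apply: cvgeZr => //; exact: hg.
have hm n : measurable_fun [set: T] (fun x => (h n x)%:E * (f x)%:E).
  by apply: emeasurable_funM => //; exact/measurable_EFinP/measurable_funP.
transitivity (limn (fun n => \int[nu]_x (h n x)%:E)).
  rewrite -monotone_convergence//.
  - by apply: eq_integral => x _; apply/esym/cvg_lim => //; exact: hg.
  - by move=> n; exact/measurable_EFinP/measurable_funP.
  - by move=> n x _; rewrite lee_fin.
  - by move=> x _ a b ab; rewrite lee_fin; exact/lefP/nd_nnsfun_approx.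
transitivity (limn (fun n => \int[mu]_x ((h n x)%:E * (f x)%:E))); last first.
  rewrite -monotone_convergence//.
  - by apply: eq_integral => x _; apply/cvg_lim => //; exact: hgf.
  - by move=> n x _; rewrite mule_ge0// lee_fin.
  - move=> x _ a b ab; rewrite lee_wpmul2r ?lee_fin//.
    exact/lefP/nd_nnsfun_approx.
congr (limn _); apply/funext => n.
have mr r : measurable_fun [set: T]
    (fun x => (\1_(h n @^-1` [set r]) x)%:E : \bar R).
  exact/measurable_EFinP.
transitivity (\int[mu]_x (\sum_(y \in range (h n))
    (y * \1_(h n @^-1` [set y]) x)%:E * (f x)%:E)); last first.
  apply: eq_integral => x _.
  rewrite -ge0_mule_fsuml => [|y]; last exact: nnfun_muleindic_ge0.
  by rewrite fsumEFin// -(fimfunE _ x).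
rewrite ge0_integral_fsum//; last 2 first.
  - move=> y; apply: emeasurable_funM => //.
    by under eq_fun do rewrite EFinM; apply: emeasurable_funM.
  - by move=> y x _; rewrite mule_ge0 ?lee_fin// -lee_fin EFinM nnfun_muleindic_ge0.
rewrite integralT_nnsfun sintegralE; apply: eq_fsbigr => r /set_mem[t _ <-].
under [RHS]eq_integral do rewrite EFinM -muleA.
rewrite ge0_integralZl//.
- congr (_ * _); rewrite /nu/= /w integral_mkcond; apply: eq_integral => x _.
  by rewrite epatch_indic/= muleC.
- by apply: emeasurable_funM.
- by move=> x _; rewrite mule_ge0 ?lee_fin.
- by rewrite lee_fin.
Qed.

(** * Borel measurability on a separable metric space *)

Lemma continuous_borel_measurable (R : realType) (X : completeMetricType R)
    (f : X -> R) :
  continuous f -> measurable_fun [set: borel X] (f : borel X -> R).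
Proof.
move=> /continuousP cf.
move=> mD; apply: (measurability _ (RGenOpens.measurableE R)) => //.
move=> _ [_ [a [b ->] <-]]; rewrite setTI; apply: sub_sigma_algebra.
exact/cf/interval_open.
Qed.

Lemma continuous_mdist (R : realType) (X : metricType R) (q : X) :
  continuous (fun x : X => mdist x q).
Proof.
move=> x; apply/cvgrPdist_lt => e e0; near=> y.
have xy : (mdist x y < e)%R.
  have : ball x e y by near: y; exact: nbhsx_ballx.
  by rewrite ballEmdist.
rewrite ltr_norml; have := metric_triangle x y q; have := metric_triangle y x q.
rewrite (metric_sym y x); lra.
Unshelve. all: by end_near. Qed.

(** Continuity at [x] only sees the ball of radius [d(x, xstar) + 1]. *)
Lemma unif_continuous_on_bounded_continuous (R : realType) (X : metricType R)
    (xstar : X) (f : X -> R) :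
  unif_continuous_on_bounded xstar f -> continuous f.
Proof.
move=> /unif_continuous_on_boundedP ucf x; apply/cvgrPdist_lt => e e0.
have r0 : (0 < mdist x xstar + 1)%R by have := mdist_ge0 x xstar; lra.
have [d d0 fd] := ucf _ r0 _ e0.
have xy c : (0 < c)%R -> (\forall y \near x, mdist x y < c)%R.
  move=> c0; have := nbhsx_ballx x _ c0.
  by rewrite ballEmdist.
near=> y; have xy1 : (mdist x y < 1)%R by near: y; exact: xy.
apply: fd; last by near: y; exact: xy.
  by rewrite /bounded_ball/=; lra.
rewrite /bounded_ball/=; have := metric_triangle y x xstar.
rewrite (metric_sym y x); lra.
Unshelve. all: by end_near. Qed.

(** For [D] a countable dense set, [d(x, y) < r] holds exactly when
    [d(x, q) + d(y, q) < r] for some [q] in [D], a countable union of measurable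
    sets of the product sigma-algebra. *)
Lemma measurable_mdist (R : realType) (X : completeMetricType R) :
  separable X ->
  measurable_fun [set: borel X * borel X]
    (fun z => mdist (z.1 : X) (z.2 : X)).
Proof.
move=> [D cD dD] mT; apply: (measurability _ (RGenInftyO.measurableE R)) => //.
move=> _ [_ [r ->] <-]; rewrite setTI.
rewrite (_ : _ @^-1` _ = \bigcup_(q in D)
  [set z : borel X * borel X |
    (mdist (z.1 : X) q + mdist (z.2 : X) q < r)%R]); last first.
  apply/seteqP; split=> [[x y]|[x y]]/=; rewrite in_itv/=.
    move=> xyr; have e0 : (0 < (r - mdist x y) / 2)%R by lra.
    have [oB xB] := open_nbhs_ball (x : X) (PosNum e0).
    have [q [/interior_subset xq Dq]] := dD _ (ex_intro _ _ xB) oB.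
    exists q => //=; move: xq; rewrite ballEmdist/= => xq.
    have := metric_triangle y x q; rewrite (metric_sym y x); lra.
  move=> [q Dq] /=; have := metric_triangle x q y.
  rewrite (metric_sym q y); lra.
have cD' : countable [set: D].
  have [f fD] := countable_injP _ cD.
  apply/countable_injP; exists (f \o set_val) => u v _ _ /= uv.
  by apply/val_inj/fD => //; exact: valP.
rewrite bigcup_set_type.
apply: countable_bigcupT_measurable => // -[q Dq]; 
rewrite -[X in measurable X]setTI /=.
have md : measurable_fun [set: borel X] (fun x => mdist (x : X) q).
  exact: (@continuous_borel_measurable _ X _ (@continuous_mdist _ X q)).
have mlt : measurable_fun [set: borel X * borel X]
    (fun z => mdist (z.1 : X) q + mdist (z.2 : X) q < r)%R.
  apply: measurable_fun_ltr => //.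
  by apply: measurable_funD; apply: (measurableT_comp md).
exact: (mlt measurableT [set true]).
Qed.

(** * Couplings of measures with densities *)

Lemma integral_image_measure d1 d2 (S : measurableType d1) (T : measurableType d2)
    (R : realType) (m : {measure set S -> \bar R}) (n : {measure set T -> \bar R})
    (phi : S -> T) (D : set T) (g : T -> \bar R) :
  measurable_fun [set: S] phi ->
  (forall A, measurable A -> m (phi @^-1` A) = n A) ->
  measurable D -> measurable_fun D g -> (forall x, 0 <= g x) ->
  \int[m]_(z in phi @^-1` D) g (phi z) = \int[n]_(x in D) g x.
Proof.
move=> mphi mn mD mg g0; transitivity (\int[pushforward m phi]_(x in D) g x).
  by rewrite (ge0_integral_pushforward mphi).
by apply: eq_measure_integral => A mA _; exact: mn.
Qed.

Lemma integralT_image_measure d1 d2 (S : measurableType d1) (T : measurableType d2)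
    (R : realType) (m : {measure set S -> \bar R}) (n : {measure set T -> \bar R})
    (phi : S -> T) (g : T -> \bar R) :
  measurable_fun [set: S] phi ->
  (forall A, measurable A -> m (phi @^-1` A) = n A) ->
  measurable_fun [set: T] g -> (forall x, 0 <= g x) ->
  \int[m]_z g (phi z) = \int[n]_x g x.
Proof.
move=> mphi mn mg g0.
by rewrite -(integral_image_measure mphi mn)// preimage_setT.
Qed.

(** The normalized product measure; when the common mass is 0, both measures
    vanish and the convention [0^-1 = 0] yields the zero measure. *)
Lemma product_coupling d1 d2 (T1 : measurableType d1) (T2 : measurableType d2)
    (R : realType) (r1 : {measure set T1 -> \bar R})
    (r2 : {measure set T2 -> \bar R}) :
  r1 [set: T1] < +oo -> r1 [set: T1] = r2 [set: T2] ->
  exists k : {measure set (T1 * T2) -> \bar R},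
    (forall A, measurable A -> k (fst @^-1` A) = r1 A) /\
    (forall A, measurable A -> k (snd @^-1` A) = r2 A).
Proof.
move=> r1oo r12.
have r2fin : fin_num_fun r2.
  move=> A mA; rewrite ge0_fin_numE//; apply: le_lt_trans r1oo.
  by rewrite r12; apply: le_measure; rewrite ?inE.
have r2sig : sigma_finite [set: T2] r2.
  by apply: fin_num_fun_sigma_finite => //; rewrite measure0.
pose r2' := HB.pack_for (SigmaFiniteMeasure.type T2 R) (Measure.sort r2)
  (isSFinite.Build _ _ _ _ (sfinite_measure_sigma_finite r2sig))
  (isSigmaFinite.Build _ _ _ _ r2sig).
have [rho rho0 rE] : exists2 rho : R, (0 <= rho)%R & r1 [set: T1] = rho%:E.
  exists (fine (r1 [set: T1])); first exact: fine_ge0.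
  by rewrite fineK// ge0_fin_numE.
have rhoV0 : (0 <= rho^-1)%R by rewrite invr_ge0.
have cancel t : 0 <= t -> t <= rho%:E -> (rho^-1)%:E * (t * rho%:E) = t.
  case: t => [t| |]// t0 trho; rewrite -!EFinM; congr EFin.
  have [rho_eq0|rho_neq0] := eqVneq rho 0%R.
    apply/esym/eqP; rewrite rho_eq0 !mulr0 eq_le.
    by move: t0 trho; rewrite !lee_fin rho_eq0 => -> ->.
  by rewrite mulrC mulfK.
pose k12 : {measure set (T1 * T2) -> \bar R} := r1 \x r2'.
have k12E A B : measurable A -> measurable B -> k12 (A `*` B) = r1 A * r2 B.
  exact: product_measure1E.
exists (mscale (NngNum rhoV0) k12); split=> A mA; rewrite /mscale.
- transitivity ((rho^-1)%:E * (r1 A * r2 [set: T2])).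
    by rewrite -k12E// setXT.
  rewrite -r12 rE cancel// -rE.
  by apply: le_measure; rewrite ?inE.
- transitivity ((rho^-1)%:E * (r1 [set: T1] * r2 A)).
    by rewrite -k12E// setTX.
  rewrite rE [_%:E * r2 A]muleC cancel// -rE r12.
  by apply: le_measure; rewrite ?inE.
Qed.

Lemma image_measure d1 d2 (S : measurableType d1) (T : measurableType d2)
    (R : realType) (m : {measure set S -> \bar R}) (phi : S -> T) :
  measurable_fun [set: S] phi ->
  exists n : {measure set T -> \bar R}, forall A, m (phi @^-1` A) = n A.
Proof.
move=> mphi.
by exists
  (measure_function_pushforward__canonical__measure_function_Measure m mphi).
Qed.

(** The pairs keep the plan [pi] on the overlap [m] of the two densities, and
    the leftover marginals are coupled independently.  A cost [c] dominated by
    [u x + v y] is integrated exactly on the first part and through its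
    dominating marginal functions on the second. *)
Lemma overlap_coupling d1 d2 (T1 : measurableType d1) (T2 : measurableType d2)
    (R : realType) (pi : {measure set (T1 * T2) -> \bar R})
    (a : T1 -> R) (b : T2 -> R) (m := fun z => Num.min (a z.1) (b z.2)) :
  measurable_fun [set: T1] a -> (forall x, (0 <= a x)%R) ->
  measurable_fun [set: T2] b -> (forall y, (0 <= b y)%R) ->
  \int[pi]_z (a z.1)%:E < +oo ->
  \int[pi]_z (a z.1)%:E = \int[pi]_z (b z.2)%:E ->
  exists g : {measure set (T1 * T2) -> \bar R},
  [/\ forall A, measurable A ->
        g (fst @^-1` A) = \int[pi]_(z in fst @^-1` A) (a z.1)%:E,
      forall B, measurable B ->
        g (snd @^-1` B) = \int[pi]_(z in snd @^-1` B) (b z.2)%:E &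
      forall (c : T1 * T2 -> \bar R) (u : T1 -> \bar R) (v : T2 -> \bar R),
        measurable_fun [set: T1 * T2] c -> (forall z, 0 <= c z) ->
        measurable_fun [set: T1] u -> (forall x, 0 <= u x) ->
        measurable_fun [set: T2] v -> (forall y, 0 <= v y) ->
        (forall z, c z <= u z.1 + v z.2) ->
        \int[g]_z c z <= \int[pi]_z (c z * (m z)%:E) +
          (\int[pi]_z (u z.1 * (a z.1 - m z)%:E) +
           \int[pi]_z (v z.2 * (b z.2 - m z)%:E))].
Proof.
move=> ma a0 mb b0 aoo abE.
have mfst : measurable_fun [set: T1 * T2] (@fst T1 T2) by exact: measurable_fst.
have msnd : measurable_fun [set: T1 * T2] (@snd T1 T2) by exact: measurable_snd.
have ma1 : measurable_fun [set: T1 * T2] (fun z => a z.1).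
  exact: (measurableT_comp ma).
have mb2 : measurable_fun [set: T1 * T2] (fun z => b z.2).
  exact: (measurableT_comp mb).
have mm : measurable_fun [set: T1 * T2] m by exact: measurable_minr.
have m0 z : (0 <= m z)%R by rewrite /m le_min a0 b0.
have mf1 : measurable_fun [set: T1 * T2] (fun z => a z.1 - m z)%R.
  exact: measurable_funB.
have mf2 : measurable_fun [set: T1 * T2] (fun z => b z.2 - m z)%R.
  exact: measurable_funB.
have f10 z : (0 <= a z.1 - m z)%R by rewrite subr_ge0 /m ge_min lexx.
have f20 z : (0 <= b z.2 - m z)%R by rewrite subr_ge0 /m ge_min lexx orbT.
have aE D : measurable D -> \int[pi]_(z in D) (a z.1)%:E =
    \int[pi]_(z in D) (m z)%:E + \int[pi]_(z in D) (a z.1 - m z)%:E.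
  move=> mD; rewrite -ge0_integralD//.
  - by apply: eq_integral => z _; rewrite -EFinD addrC subrK.
  - by move=> z _; rewrite lee_fin.
  - exact/measurable_EFinP/measurable_funTS.
  - by move=> z _; rewrite lee_fin.
  - exact/measurable_EFinP/measurable_funTS.
have bE D : measurable D -> \int[pi]_(z in D) (b z.2)%:E =
    \int[pi]_(z in D) (m z)%:E + \int[pi]_(z in D) (b z.2 - m z)%:E.
  move=> mD; rewrite -ge0_integralD//.
  - by apply: eq_integral => z _; rewrite -EFinD addrC subrK.
  - by move=> z _; rewrite lee_fin.
  - exact/measurable_EFinP/measurable_funTS.
  - by move=> z _; rewrite lee_fin.
  - exact/measurable_EFinP/measurable_funTS.
have ET := aE _ measurableT; have FT := bE _ measurableT.
have Im0 : 0 <= \int[pi]_z (m z)%:E.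
  by apply: integral_ge0 => z _; rewrite lee_fin.
have If0 : 0 <= \int[pi]_z (a z.1 - m z)%:E.
  by apply: integral_ge0 => z _; rewrite lee_fin.
have Imfin : \int[pi]_z (m z)%:E \is a fin_num.
  by rewrite ge0_fin_numE//; apply: le_lt_trans aoo; rewrite ET leeDl.
have [M [ME MI]] := density_measure pi mm m0.
have [N1 [N1E N1I]] := density_measure pi mf1 f10.
have [N2 [N2E N2I]] := density_measure pi mf2 f20.
have [r1 r1E] := image_measure N1 mfst.
have [r2 r2E] := image_measure N2 msnd.
have r1T : r1 [set: T1] = \int[pi]_z (a z.1 - m z)%:E.
  by rewrite -r1E N1E// preimage_setT.
have r2T : r2 [set: T2] = \int[pi]_z (b z.2 - m z)%:E.
  by rewrite -r2E N2E// preimage_setT.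
have [||k [k1 k2]] := @product_coupling _ _ _ _ _ r1 r2.
- by rewrite r1T; apply: le_lt_trans aoo; rewrite ET leeDr.
(* the overlap has finite mass and cancels from both total masses *)
- have K x : \int[pi]_z (m z)%:E + x - \int[pi]_z (m z)%:E = x.
    by rewrite [X in X - _]addeC addeK.
  by rewrite r1T r2T -[LHS]K -[RHS]K -ET -FT abE.
exists (measure_add M k); split.
- move=> A mA; have mfA : measurable (@fst T1 T2 @^-1` A).
    by rewrite -[X in measurable X]setTI; exact: mfst.
  by rewrite [LHS]measure_addE k1// -r1E ME// N1E// aE.
- move=> A mA; have mfA : measurable (@snd T1 T2 @^-1` A).
    by rewrite -[X in measurable X]setTI; exact: msnd.
  by rewrite [LHS]measure_addE k2// -r2E ME// N2E// bE.
move=> c u v mc c0 mu u0 mv v0 cuv.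
have mu1 : measurable_fun [set: T1 * T2] (fun z => u z.1).
  exact: (measurableT_comp mu).
have mv2 : measurable_fun [set: T1 * T2] (fun z => v z.2).
  exact: (measurableT_comp mv).
rewrite ge0_integral_measure_add// MI// leeD2l//.
rewrite -N1I// -N2I//.
rewrite (integralT_image_measure mfst (n := r1))//.
rewrite (integralT_image_measure msnd (n := r2))//.
rewrite -(integralT_image_measure mfst k1)// -(integralT_image_measure msnd k2)//.
rewrite -ge0_integralD//.
by apply: ge0_le_integral => //; exact: emeasurable_funD.
Qed.

(** Repackages a measure of total mass 1, so that it can serve as a coupling. *)
Lemma probability_of_mass1 d (T : measurableType d) (R : realType)
    (m : {measure set T -> \bar R}) :
  m [set: T] = 1 -> exists P : probability T R, forall A, P A = m A.
Proof.
move=> m1; have mfin : fin_num_fun m.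
  move=> A mA; rewrite ge0_fin_numE//.
  apply: (@le_lt_trans _ _ (m [set: T])); last by rewrite m1 ltry.
  by apply: le_measure; rewrite ?inE.
exists (mnormalize m (dirac point)) => A.
by rewrite /= /mnormalize m1 onee_eq0 /= invr1 mule1.
Qed.

(** * Integrals of nonnegative real-valued functions *)

Section real_integrals.
Context d (T : measurableType d) (R : realType) (m : {measure set T -> \bar R}).
Implicit Types f g : T -> R.

Lemma integral_EFinD f g :
  measurable_fun [set: T] f -> (forall x, (0 <= f x)%R) ->
  measurable_fun [set: T] g -> (forall x, (0 <= g x)%R) ->
  \int[m]_x (f x + g x)%:E = \int[m]_x (f x)%:E + \int[m]_x (g x)%:E.
Proof.
move=> mf f0 mg g0; rewrite -ge0_integralD//.
- by move=> x _; rewrite lee_fin.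
- exact/measurable_EFinP.
- by move=> x _; rewrite lee_fin.
- exact/measurable_EFinP.
Qed.

Lemma integral_EFinZ (k : R) f :
  (0 <= k)%R -> measurable_fun [set: T] f -> (forall x, (0 <= f x)%R) ->
  \int[m]_x (k * f x)%:E = k%:E * \int[m]_x (f x)%:E.
Proof.
move=> k0 mf f0; rewrite -ge0_integralZl//.
- exact/measurable_EFinP.
- by move=> x _; rewrite lee_fin.
Qed.

Lemma le_integral_EFin f g :
  measurable_fun [set: T] f -> (forall x, (0 <= f x)%R) ->
  measurable_fun [set: T] g -> (forall x, (f x <= g x)%R) ->
  \int[m]_x (f x)%:E <= \int[m]_x (g x)%:E.
Proof.
move=> mf f0 mg fg; apply: ge0_le_integral => //.
- by move=> x _; rewrite lee_fin.
- exact/measurable_EFinP.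
- exact/measurable_EFinP.
- by move=> x _; rewrite lee_fin.
Qed.

End real_integrals.

(** * Wasserstein distance and couplings *)

Section wasserstein_couplings.
Context {R : realType} {X : completeMetricType R}.
Implicit Types (p : R) (mu nu : probability (borel X) R).

Let expoK p (x : R) : (1 <= p)%R -> (0 <= x)%R -> ((x `^ p) `^ p^-1 = x)%R.
Proof. by move=> p1 x0; rewrite -powRrM mulfV ?powRr1//; lra. Qed.

Lemma coupling_of_wasserstein_lt p mu nu (eta : R) :
  (1 <= p)%R -> (0 < eta)%R ->
  wasserstein p mu nu < (eta `^ p^-1)%:E ->
  exists2 pi, couplings mu nu pi &
    \int[pi]_z ((mdist (z.1 : X) (z.2 : X) `^ p)%R)%:E < eta%:E.
Proof.
move=> p1 eta0; rewrite /wasserstein; set I := ereal_inf _ => Ilt.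
suff /ereal_inf_lt[_ [pi cpi <-] pieta] : I < eta%:E by exists pi.
rewrite ltNge; apply/negP => etaI.
have I0 : 0 <= I by apply: le_trans etaI; rewrite lee_fin ltW.
move: Ilt; rewrite ltNge -poweR_EFin => /negP; apply.
apply: gt0_ler_poweR => //.
- by rewrite invr_ge0; lra.
- by rewrite in_itv/= leey lee_fin ltW.
- by rewrite in_itv/= leey I0.
Qed.

Lemma wasserstein_lt_of_coupling p mu nu pi (c eps : R) :
  (1 <= p)%R -> (0 < eps)%R -> couplings mu nu pi ->
  \int[pi]_z ((mdist (z.1 : X) (z.2 : X) `^ p)%R)%:E <= c%:E ->
  (c < eps `^ p)%R ->
  wasserstein p mu nu < eps%:E.
Proof.
move=> p1 eps0 cpi; set J := \int[pi]_z _ => Jc ceps.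
have J0 : 0 <= J by apply: integral_ge0 => z _; rewrite lee_fin powR_ge0.
have pV0 : (0 < p^-1)%R by rewrite invr_gt0; lra.
rewrite /wasserstein; set I := ereal_inf _.
have I0 : 0 <= I.
  apply: le_ereal_inf_tmp => _ [pi' _ <-].
  by apply: integral_ge0 => z _; rewrite lee_fin powR_ge0.
have Ic : I <= c%:E by apply: le_trans Jc; apply: ereal_inf_lbound; exists pi.
have c0 : (0 <= c)%R by rewrite -lee_fin (le_trans I0).
apply: (@le_lt_trans _ _ (c%:E `^ p^-1)).
  by apply: gt0_ler_poweR => //; rewrite ?in_itv/= ?leey ?I0 ?lee_fin ?c0// ltW.
rewrite poweR_EFin lte_fin -[ltRHS](expoK p1 (ltW eps0)).
by apply: gt0_ltr_powR; rewrite // ?nnegrE// powR_ge0.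
Qed.

End wasserstein_couplings.

(** * Moment tails *)

Section tails.
Context {R : realType} {X : completeMetricType R}.
Variables (xstar : X) (p : R).
Hypothesis p1 : (1 <= p)%R.

Let p0 : (0 <= p)%R. Proof. exact: le_trans p1. Qed.
Implicit Types (mu nu : probability (borel X) R).

(** The integrand of [moment_tail], extended by 0 to the whole space so that it
    can be added to other functions. *)
Definition tail_cost (r : R) (x : X) : R :=
  if (r < mdist x xstar)%R then (mdist x xstar `^ p)%R else 0%R.

Lemma tail_cost_ge0 r x : (0 <= tail_cost r x)%R.
Proof. by rewrite /tail_cost; case: ifP => // _; exact: powR_ge0. Qed.

Lemma measurable_mdist_star :
  measurable_fun [set: borel X] (fun x => mdist (x : X) xstar).
Proof.
exact: (@continuous_borel_measurable _ X _ (@continuous_mdist _ X xstar)).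
Qed.

Lemma measurable_mdist_starX :
  measurable_fun [set: borel X] (fun x => mdist (x : X) xstar `^ p)%R.
Proof.
exact: (measurableT_comp (measurable_powR p) measurable_mdist_star).
Qed.

Lemma measurable_tail_cost r :
  measurable_fun [set: borel X] (tail_cost r : borel X -> R).
Proof.
apply: measurable_fun_ifT => //; last exact: measurable_mdist_starX.
by apply: measurable_fun_ltr => //; exact: measurable_mdist_star.
Qed.

Lemma integral_tail_cost r mu :
  \int[mu]_x (tail_cost r x)%:E =
  \int[mu]_(x in [set x : borel X | (r < mdist (x : X) xstar)%R])
     ((mdist (x : X) xstar `^ p)%R)%:E.
Proof.
rewrite [RHS]integral_mkcond; apply: eq_integral => x _.
rewrite /tail_cost /patch; case: ifPn => rx; first by rewrite mem_set.
by rewrite memNset//; exact/negP.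
Qed.

Lemma tail_cost_small (C : set (probability (borel X) R)) (t : R) :
  moment_tail xstar p C r @[r --> +oo%R] --> 0 -> (0 < t)%R ->
  exists2 r : R, (1 <= r)%R &
    forall mu, C mu -> \int[mu]_x (tail_cost r x)%:E <= t%:E.
Proof.
move=> Ct t0.
have /Ct : nbhs (0 : \bar R) [set y | y < t%:E].
  by apply: open_nbhs_nbhs; split; [exact: open_ereal_lt_ereal|
    rewrite /= lte_fin].
move=> /= [M [Mreal HM]].
exists (Num.max 1 (M + 1))%R; first by rewrite le_max lexx.
have /HM/= tl : (M < Num.max 1 (M + 1))%R by rewrite lt_max ltrDl ltr01 orbT.
move=> mu Cmu; rewrite integral_tail_cost; apply: le_trans (ltW tl).
by apply: ereal_sup_ubound; exists mu.
Qed.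

Lemma le_moment_tail_cost (r : R) x : (0 <= r)%R ->
  (mdist x xstar `^ p <= r `^ p + tail_cost r x)%R.
Proof.
move=> r0; rewrite /tail_cost; case: ltP => xr.
  by rewrite lerDr powR_ge0.
by rewrite addr0 ge0_ler_powR ?nnegrE ?mdist_ge0.
Qed.

(** The sum of the distances to [xstar] is at most twice the larger one, whose
    p-th power is at most the sum of both p-th powers. *)
Lemma mdist_powR_triangle (x y : X) :
  (mdist x y `^ p <=
   2 `^ p * mdist x xstar `^ p + 2 `^ p * mdist y xstar `^ p)%R.
Proof.
set a := mdist x xstar; set b := mdist y xstar.
have a0 : (0 <= a)%R by exact: mdist_ge0.
have b0 : (0 <= b)%R by exact: mdist_ge0.
have xyab : (mdist x y <= a + b)%R.
  by rewrite /b (metric_sym y); exact: metric_triangle.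
have step (c : R) : (0 <= c)%R -> (a + b <= 2 * c)%R ->
    (mdist x y `^ p <= 2 `^ p * c `^ p)%R.
  move=> c0 abc; rewrite -powRM//; apply: ge0_ler_powR.
  - exact: p0.
  - by rewrite nnegrE mdist_ge0.
  - by rewrite nnegrE mulr_ge0.
  - exact: le_trans abc.
have [ab|ba] := leP a b.
- apply: (le_trans (step b b0 _)); first lra.
  by rewrite lerDr mulr_ge0// powR_ge0.
- apply: (le_trans (step a a0 _)); first lra.
  by rewrite lerDl mulr_ge0// powR_ge0.
Qed.

End tails.

(** * Variation of the likelihood along a coupling *)

Section likelihood_gap.
Context {R : realType} {X : completeMetricType R}.
Variables (sepX : separable X) (xstar : X) (p : R) (L : X -> R).
Hypothesis p1 : (1 <= p)%R.
Hypothesis L01 : forall x, (0 <= L x <= 1)%R.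
Hypothesis ucL : unif_continuous_on_bounded xstar L.
Implicit Types (mu nu : probability (borel X) R).

Let p0 : (0 <= p)%R. Proof. exact: le_trans p1. Qed.

Lemma measurable_likelihood : measurable_fun [set: borel X] (L : borel X -> R).
Proof.
exact: continuous_borel_measurable (unif_continuous_on_bounded_continuous ucL).
Qed.

Lemma measurable_mdistX :
  measurable_fun [set: borel X * borel X]
    (fun z => mdist (z.1 : X) (z.2 : X) `^ p)%R.
Proof.
exact: (measurableT_comp (measurable_powR p) (measurable_mdist sepX)).
Qed.

(** At least one of four terms wins: both points lie in the ball of radius [r]
    and within [d] of each other, or one of the last three terms is already at
    least 1.  The assumption [1 <= r] makes a point outside the ball contribute
    at least 1. *)
Lemma likelihood_gap_pointwise (r e d : R) :
  (1 <= r)%R -> (0 <= e)%R -> (0 < d)%R ->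
  (forall x y : X, bounded_ball xstar r x -> bounded_ball xstar r y ->
     (mdist x y < d)%R -> (`|L x - L y| < e)%R) ->
  forall x y : X,
  (`|L x - L y| <= e + tail_cost xstar p r x + tail_cost xstar p r y
                   + (d `^ p)^-1 * mdist x y `^ p)%R.
Proof.
move=> r1 e0 d0 Ld x y.
have L1 : (`|L x - L y| <= 1)%R.
  by have := L01 x; have := L01 y; rewrite ler_norml; lra.
have tx := tail_cost_ge0 xstar p r x; have ty := tail_cost_ge0 xstar p r y.
have dp : (0 < d `^ p)%R by exact: powR_gt0.
have dxy0 : (0 <= (d `^ p)^-1 * mdist x y `^ p)%R.
  by rewrite mulr_ge0 ?invr_ge0 ?powR_ge0.
have far z : (r < mdist z xstar)%R -> (1 <= tail_cost xstar p r z)%R.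
  move=> rz; have p11 : (1 = 1 `^ p :> R)%R by rewrite powR1.
  rewrite /tail_cost rz [leLHS]p11.
  by apply: ge0_ler_powR; rewrite ?nnegrE ?p0//; lra.
have [xr|/far] := leP (mdist x xstar) r; last lra.
have [yr|/far] := leP (mdist y xstar) r; last lra.
have [/(Ld x y xr yr)|dxy] := ltP (mdist x y) d; first lra.
suff : (1 <= (d `^ p)^-1 * mdist x y `^ p)%R by lra.
rewrite mulrC ler_pdivlMr// mul1r.
by apply: ge0_ler_powR; rewrite ?nnegrE ?p0//; lra.
Qed.

(** Integrating the pointwise bound gives four terms, each of which is made at
    most [s / 4]; the last one fixes [eta]. *)
Lemma likelihood_gap (C : set (probability (borel X) R)) (s : R) :
  moment_tail xstar p C r @[r --> +oo%R] --> 0 -> (0 < s)%R ->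
  exists2 eta : R, (0 < eta)%R & forall mu nu pi, C mu -> C nu ->
    couplings mu nu pi ->
    \int[pi]_z ((mdist (z.1 : X) (z.2 : X) `^ p)%R)%:E <= eta%:E ->
    \int[pi]_z (`|L z.1 - L z.2|%R)%:E <= s%:E.
Proof.
move=> Ct s0; have e0 : (0 < s / 4)%R by rewrite divr_gt0.
have [r r1 tr] := tail_cost_small Ct e0.
have r0 : (0 < r)%R by lra.
have [d d0 Ld] := (unif_continuous_on_boundedP xstar L).1 ucL _ r0 _ e0.
have dp : (0 < d `^ p)%R by exact: powR_gt0.
(* Markov: [(d^p)^-1] times this cost is [s / 4] *)
exists (s / 4 * d `^ p)%R; first by rewrite mulr_gt0.
move=> mu nu pi Cmu Cnu cpi pid.
have mt := measurable_tail_cost xstar p r.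
have mt1 : measurable_fun [set: borel X * borel X]
    (fun z => tail_cost xstar p r z.1).
  exact: (measurableT_comp mt).
have mt2 : measurable_fun [set: borel X * borel X]
    (fun z => tail_cost xstar p r z.2).
  exact: (measurableT_comp mt).
have mL1 : measurable_fun [set: borel X * borel X] (fun z => L z.1).
  exact: (measurableT_comp measurable_likelihood).
have mL2 : measurable_fun [set: borel X * borel X] (fun z => L z.2).
  exact: (measurableT_comp measurable_likelihood).
have t0 := tail_cost_ge0 xstar p r.
have mtE : measurable_fun [set: borel X] (EFin \o tail_cost xstar p r).
  exact/measurable_EFinP.
have t0E x : 0 <= (tail_cost xstar p r x)%:E by rewrite lee_fin.
have mdp := measurable_mdistX.
have kmd : measurable_fun [set: borel X * borel X]
    (fun z => (d `^ p)^-1 * mdist (z.1 : X) (z.2 : X) `^ p)%R.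
  exact: measurable_funM.
apply: (@le_trans _ _ (\int[pi]_z (s / 4 + tail_cost xstar p r z.1
    + tail_cost xstar p r z.2
    + (d `^ p)^-1 * mdist (z.1 : X) (z.2 : X) `^ p)%:E)).
  apply: le_integral_EFin => //.
  - by apply: measurableT_comp => //; exact: measurable_funB.
  - by do 3! [apply: measurable_funD => //].
  - move=> z; exact: (likelihood_gap_pointwise r1 (ltW e0) d0 Ld).
rewrite !integral_EFinD//; first last.
- by move=> z; rewrite mulr_ge0 ?invr_ge0 ?powR_ge0.
- by move=> z; rewrite !addr_ge0 ?(ltW e0).
- by do 2! [apply: measurable_funD => //].
- by move=> z; rewrite addr_ge0 ?(ltW e0).
- exact: measurable_funD.
- by move=> _; exact: ltW.
rewrite integral_cst//= probability_setT mule1.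
rewrite [X in _ + X]integral_EFinZ ?invr_ge0 ?powR_ge0//; last first.
  by move=> z; exact: powR_ge0.
have tmu := integralT_image_measure measurable_fst
  (fun A mA => (cpi A mA).1) mtE t0E.
have tnu := integralT_image_measure measurable_snd
  (fun A mA => (cpi A mA).2) mtE t0E.
rewrite [X in _ + X + _ + _]tmu [X in _ + _ + X + _]tnu.
rewrite [leRHS](_ : _ = (s / 4)%:E + (s / 4)%:E + (s / 4)%:E
    + ((d `^ p)^-1)%:E * (s / 4 * d `^ p)%:E); last first.
  rewrite -EFinM -!EFinD; congr EFin.
  by rewrite mulrCA mulVf ?gt_eqF// mulr1; lra.
apply: leeD; last by apply: lee_wpmul2l; rewrite ?lee_fin ?invr_ge0 ?powR_ge0.
by apply: leeD; [apply: leeD => //; exact: tr|exact: tr].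
Qed.

End likelihood_gap.

(** * Coupling of the posteriors *)

(** Splitting the weight as [w <= M + tau], the bounded part [M] is paired with
    the fine bound on [f] and the tail [tau] with the crude bound [c]. *)
Lemma residual_cost d (T : measurableType d) (R : realType)
    (m : {measure set T -> \bar R}) (w f tau h q : T -> R) (k c M s t : R) :
  measurable_fun [set: T] w -> measurable_fun [set: T] f ->
  measurable_fun [set: T] tau -> measurable_fun [set: T] h ->
  measurable_fun [set: T] q ->
  (forall z, (0 <= w z)%R) -> (forall z, (0 <= f z)%R) ->
  (forall z, (0 <= tau z)%R) -> (forall z, (0 <= h z)%R) ->
  (forall z, (0 <= q z)%R) ->
  (0 <= k)%R -> (0 <= c)%R -> (0 <= M)%R -> (0 <= s)%R ->
  (forall z, (w z <= M + tau z)%R) -> (forall z, (f z <= c)%R) ->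
  (forall z, (f z <= c * (h z + s * q z))%R) ->
  \int[m]_z (tau z)%:E <= t%:E -> \int[m]_z (h z)%:E <= s%:E ->
  \int[m]_z (q z)%:E <= 1 ->
  \int[m]_z ((k * w z)%:E * (f z)%:E) <= (k * c * (t + M * (s + s)))%:E.
Proof.
move=> mw mf mtau mh mq w0 f0 tau0 h0 q0 k0 c0 M0 s0 wM fc fh It Ih Iq.
have msq : measurable_fun [set: T] (fun z => s * q z)%R by exact: measurable_funM.
have sq0 z : (0 <= s * q z)%R by rewrite mulr_ge0.
have mhq : measurable_fun [set: T] (fun z => h z + s * q z)%R.
  exact: measurable_funD.
have hq0 z : (0 <= h z + s * q z)%R by rewrite addr_ge0.
have mMhq : measurable_fun [set: T] (fun z => M * (h z + s * q z))%R.
  exact: measurable_funM.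
have Mhq0 z : (0 <= M * (h z + s * q z))%R by rewrite mulr_ge0.
have mtot : measurable_fun [set: T] (fun z => tau z + M * (h z + s * q z))%R.
  exact: measurable_funD.
have tot0 z : (0 <= tau z + M * (h z + s * q z))%R by rewrite addr_ge0.
have kc0 : (0 <= k * c)%R by rewrite mulr_ge0.
under eq_integral do rewrite -EFinM.
apply: (@le_trans _ _
    (\int[m]_z (k * c * (tau z + M * (h z + s * q z)))%:E)).
  apply: le_integral_EFin => //.
  - by apply: measurable_funM => //; exact: measurable_funM.
  - by move=> z; rewrite !mulr_ge0.
  - exact: measurable_funM.
  - move=> z; rewrite -!mulrA ler_wpM2l//.
    apply: (@le_trans _ _ ((M + tau z) * f z)%R); first exact: ler_wpM2r.
    rewrite mulrDl addrC mulrDr mulrCA lerD//.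
      by rewrite mulrC ler_wpM2r.
    by rewrite ler_wpM2l.
rewrite integral_EFinZ// [leRHS]EFinM; apply: lee_wpmul2l.
  by rewrite lee_fin.
rewrite integral_EFinD// [leRHS]EFinD leeD//.
rewrite integral_EFinZ// [leRHS]EFinM; apply: lee_wpmul2l.
  by rewrite lee_fin.
rewrite integral_EFinD// [leRHS]EFinD leeD//.
rewrite integral_EFinZ// -[leRHS]mule1.
by apply: lee_wpmul2l; rewrite ?lee_fin.
Qed.

Section posterior_coupling.
Context {R : realType} {X : completeMetricType R}.
Variables (sepX : separable X) (xstar : X) (p : R) (L : X -> R).
Hypothesis p1 : (1 <= p)%R.
Hypothesis L01 : forall x, (0 <= L x <= 1)%R.
Hypothesis mL : measurable_fun [set: borel X] (L : borel X -> R).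
Implicit Types (mu nu : probability (borel X) R).

Let L0 x : (0 <= L x)%R. Proof. by have /andP[] := L01 x. Qed.

Lemma posterior_density mu (Z : R) (A : set (borel X)) :
  (0 < Z)%R -> evidence L mu = Z%:E -> measurable A ->
  posterior L mu A = \int[mu]_(x in A) (Z^-1 * L x)%:E.
Proof.
move=> Z0 ZE mA; rewrite posteriorE ?ZE//; last by rewrite lte_fin Z0 ltry.
rewrite -ge0_integralZl//.
- exact/measurable_EFinP/measurable_funTS.
- by move=> x _; rewrite lee_fin.
- by rewrite lee_fin invr_ge0 ltW.
Qed.

Lemma evidence_bounds (C : set (probability (borel X) R)) (zeta : R) mu :
  zeta%:E <= ereal_inf [set evidence L mu | mu in C] -> C mu ->
  exists2 Z : R, (zeta <= Z)%R & evidence L mu = Z%:E.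
Proof.
move=> zC Cmu.
have zZ : zeta%:E <= evidence L mu.
  by apply: le_trans zC _; apply: ereal_inf_lbound; exists mu.
have Z1 : evidence L mu <= 1.
  apply: (@le_trans _ _ (\int[mu]_(x in setT) (1%R)%:E)).
    apply: le_integral_EFin => // x.
    by have /andP[] := L01 x.
  by rewrite integral_cst//= probability_setT mul1e.
have Zfin : evidence L mu \is a fin_num.
  rewrite ge0_fin_numE; first exact: le_lt_trans Z1 (ltry _).
  by apply: integral_ge0 => x _; rewrite lee_fin.
by exists (fine (evidence L mu)); rewrite ?fineK// -lee_fin fineK.
Qed.

Lemma finite_moment_posterior mu (Z : R) :
  (0 < Z)%R -> evidence L mu = Z%:E -> finite_moment xstar p mu ->
  finite_moment xstar p (posterior L mu).
Proof.
move=> Z0 ZE; rewrite /finite_moment/= /moment => fmu.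
have mf : measurable_fun [set: borel X] (fun x => Z^-1 * L x)%R.
  exact: measurable_funM.
have f0 x : (0 <= Z^-1 * L x)%R by rewrite mulr_ge0// invr_ge0 ltW.
have [n [nE nI]] := density_measure mu mf f0.
have mx := measurable_mdist_starX xstar p.
rewrite (eq_measure_integral n); last first.
  by move=> A mA _; rewrite nE//; exact: posterior_density.
rewrite nI; last 2 first.
- exact/measurable_EFinP.
- by move=> x; rewrite lee_fin powR_ge0.
apply: (@le_lt_trans _ _
    (\int[mu]_x (Z^-1 * mdist (x : X) xstar `^ p)%:E)).
  under eq_integral do rewrite -EFinM.
  apply: le_integral_EFin => //.
  - exact: measurable_funM.
  - by move=> x; rewrite mulr_ge0 ?powR_ge0.
  - exact: measurable_funM.
  - move=> x; rewrite mulrC ler_wpM2r ?powR_ge0// ler_piMr ?invr_ge0 ?(ltW Z0)//.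
    by have /andP[] := L01 x.
rewrite integral_EFinZ ?invr_ge0 ?ltW//; last by move=> x; exact: powR_ge0.
by rewrite lte_mul_pinfty// lee_fin invr_ge0 ltW.
Qed.

(** Follows from [lx / Z - ly / Z' = ((lx - ly) + (Z' - Z) (ly / Z')) / Z]. *)
Lemma residual_density_bound (zeta Z Z' lx ly s : R) :
  (0 < zeta)%R -> (zeta <= Z)%R -> (zeta <= Z')%R ->
  (0 <= lx <= 1)%R -> (0 <= ly <= 1)%R -> (`|Z - Z'| <= s)%R ->
  (Z^-1 * lx - Num.min (Z^-1 * lx) (Z'^-1 * ly) <=
   zeta^-1 * (`|lx - ly| + s * (Z'^-1 * ly)))%R.
Proof.
move=> z0 zZ zZ' /andP[lx0 lx1] /andP[ly0 ly1] Zs.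
have Z0 : (0 < Z)%R by lra.
have Z'0 : (0 < Z')%R by lra.
have zV : (0 < zeta^-1)%R by rewrite invr_gt0.
have Zz : (Z^-1 <= zeta^-1)%R by rewrite lef_pV2.
have ZV0 : (0 <= Z^-1)%R by rewrite invr_ge0 ltW.
have s0 : (0 <= s)%R by apply: le_trans Zs.
have b0 : (0 <= Z'^-1 * ly)%R by rewrite mulr_ge0// invr_ge0 ltW.
have rhs0 : (0 <= `|lx - ly| + s * (Z'^-1 * ly))%R.
  by rewrite addr_ge0// mulr_ge0.
have [ab|ba] := leP (Z^-1 * lx)%R (Z'^-1 * ly)%R.
  by rewrite subrr mulr_ge0// ltW.
apply: (@le_trans _ _ (Z^-1 * (`|lx - ly| + s * (Z'^-1 * ly)))%R); last first.
  exact: ler_wpM2r.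
have -> : (Z^-1 * lx - Z'^-1 * ly =
    Z^-1 * ((lx - ly) + (Z' - Z) * (Z'^-1 * ly)))%R.
  by field; rewrite !gt_eqF.
rewrite ler_wpM2l// lerD ?ler_norm// ler_wpM2r//.
by apply: le_trans Zs; rewrite distrC ler_norm.
Qed.

(** The overlap coupling of the two posterior densities with
    [u = v = 2^p d(-, xstar)^p]; the term [zeta^-1 * eta] pays for the shared
    mass, and each leftover marginal costs at most [zeta^-1 2^p (t + 2 r^p s)]. *)
Lemma posterior_coupling_cost mu nu (zeta Z Z' r eta s t : R)
    (pi : probability (borel X * borel X)%type R) :
  (0 < zeta)%R -> (zeta <= Z)%R -> (zeta <= Z')%R -> (0 <= r)%R ->
  evidence L mu = Z%:E -> evidence L nu = Z'%:E -> couplings mu nu pi ->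
  \int[pi]_z ((mdist (z.1 : X) (z.2 : X) `^ p)%R)%:E <= eta%:E ->
  \int[pi]_z (`|L z.1 - L z.2|%R)%:E <= s%:E ->
  \int[mu]_x (tail_cost xstar p r x)%:E <= t%:E ->
  \int[nu]_x (tail_cost xstar p r x)%:E <= t%:E ->
  exists2 g, couplings (posterior L mu) (posterior L nu) g &
    \int[g]_z ((mdist (z.1 : X) (z.2 : X) `^ p)%R)%:E <=
    (zeta^-1 * (eta + 2 `^ p * (2 * t + 4 * (r `^ p * s))))%:E.
Proof.
move=> z0 zZ zZ' r0 ZE Z'E cpi pid piL tmu tnu.
have Z0 : (0 < Z)%R by lra.
have Z'0 : (0 < Z')%R by lra.
have zV : (0 < zeta^-1)%R by rewrite invr_gt0.
have ZV0 : (0 <= Z^-1)%R by rewrite invr_ge0 ltW.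
have Z'V0 : (0 <= Z'^-1)%R by rewrite invr_ge0 ltW.
have cpi1 A : measurable A -> pi (fst @^-1` A) = mu A.
  by move=> mA; exact: (cpi A mA).1.
have cpi2 A : measurable A -> pi (snd @^-1` A) = nu A.
  by move=> mA; exact: (cpi A mA).2.
pose a (x : borel X) := (Z^-1 * L x)%R; pose b (y : borel X) := (Z'^-1 * L y)%R.
have ma : measurable_fun [set: borel X] a by exact: measurable_funM.
have mb : measurable_fun [set: borel X] b by exact: measurable_funM.
have a0 x : (0 <= a x)%R by rewrite mulr_ge0.
have b0 x : (0 <= b x)%R by rewrite mulr_ge0.
have a0E x : 0 <= (a x)%:E by rewrite lee_fin.
have b0E x : 0 <= (b x)%:E by rewrite lee_fin.
have aE A : measurable A ->
    \int[pi]_(z in fst @^-1` A) (a z.1)%:E = posterior L mu A.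
  move=> mA; rewrite (posterior_density Z0 ZE)//.
  apply: (integral_image_measure measurable_fst cpi1 mA (g := EFin \o a)) => //.
  exact/measurable_EFinP/measurable_funTS.
have bE A : measurable A ->
    \int[pi]_(z in snd @^-1` A) (b z.2)%:E = posterior L nu A.
  move=> mA; rewrite (posterior_density Z'0 Z'E)//.
  apply: (integral_image_measure measurable_snd cpi2 mA (g := EFin \o b)) => //.
  exact/measurable_EFinP/measurable_funTS.
have aT : \int[pi]_z (a z.1)%:E = 1.
  by have := aE _ measurableT; rewrite preimage_setT probability_setT.
have bT : \int[pi]_z (b z.2)%:E = 1.
  by have := bE _ measurableT; rewrite preimage_setT probability_setT.
have [||g [g1 g2 gc]] := overlap_coupling ma a0 mb b0 (pi := pi).
- by rewrite aT ltry.
- by rewrite aT bT.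
have [|G GE] := probability_of_mass1 (m := g).
  by have := g1 _ measurableT; rewrite !preimage_setT aT.
exists G.
  move=> A mA; rewrite /pushforward !GE; split.
    by rewrite g1// aE.
  by rewrite g2// bE.
rewrite (eq_measure_integral g); last by move=> A _ _; exact: GE.
have mL1 : measurable_fun [set: borel X * borel X] (fun z => L z.1).
  exact: (measurableT_comp mL).
have mL2 : measurable_fun [set: borel X * borel X] (fun z => L z.2).
  exact: (measurableT_comp mL).
have mD : measurable_fun [set: borel X * borel X] (fun z => `|L z.1 - L z.2|)%R.
  by apply: measurableT_comp => //; exact: measurable_funB.
have ma1 : measurable_fun [set: borel X * borel X] (fun z => a z.1).
  exact: (measurableT_comp ma).
have mb2 : measurable_fun [set: borel X * borel X] (fun z => b z.2).
  exact: (measurableT_comp mb).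
have s0 : (0 <= s)%R.
  rewrite -lee_fin; apply: le_trans piL.
  by apply: integral_ge0 => z _; rewrite lee_fin.
have mLE : measurable_fun [set: borel X] (EFin \o (L : borel X -> R)).
  exact/measurable_EFinP.
have L0E x : 0 <= (EFin \o L) x by rewrite lee_fin.
have IL1 : \int[pi]_z (L z.1)%:E = Z%:E.
  by rewrite -ZE; exact: (integralT_image_measure measurable_fst cpi1 mLE L0E).
have IL2 : \int[pi]_z (L z.2)%:E = Z'%:E.
  by rewrite -Z'E; exact: (integralT_image_measure measurable_snd cpi2 mLE L0E).
(* integrate [L x <= L y + |L x - L y|] and its mirror image *)
have ZZ' : (`|Z - Z'| <= s)%R.
  have h1 : (Z <= Z' + s)%R.
    rewrite -lee_fin EFinD -IL1 -IL2.
    apply: (@le_trans _ _ (\int[pi]_z (L z.2 + `|L z.1 - L z.2|)%:E)).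
      apply: le_integral_EFin => //; first exact: measurable_funD.
      by move=> z; rewrite -lerBlDl ler_norm.
    by rewrite integral_EFinD// leeD2l.
  have h2 : (Z' <= Z + s)%R.
    rewrite -lee_fin EFinD -IL1 -IL2.
    apply: (@le_trans _ _ (\int[pi]_z (L z.1 + `|L z.1 - L z.2|)%:E)).
      apply: le_integral_EFin => //; first exact: measurable_funD.
      by move=> z; rewrite -lerBlDl distrC ler_norm.
    by rewrite integral_EFinD// leeD2l.
  by rewrite ler_norml; lra.
set m := fun z : borel X * borel X => Num.min (a z.1) (b z.2) in gc.
have mm : measurable_fun [set: borel X * borel X] m by exact: measurable_minr.
have m0 z : (0 <= m z)%R by rewrite /m le_min a0 b0.
have az y : (a y <= zeta^-1)%R.
  have /andP[Ly0 Ly1] := L01 y.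
  by apply: (@le_trans _ _ Z^-1)%R; [rewrite ler_piMr|rewrite lef_pV2].
have bz y : (b y <= zeta^-1)%R.
  have /andP[Ly0 Ly1] := L01 y.
  by apply: (@le_trans _ _ Z'^-1)%R; [rewrite ler_piMr|rewrite lef_pV2].
have mrho := measurable_mdist_starX xstar p.
have mtau := measurable_tail_cost xstar p r.
have tau0E x : 0 <= (tail_cost xstar p r x)%:E by rewrite lee_fin tail_cost_ge0.
have mtauE : measurable_fun [set: borel X] (EFin \o tail_cost xstar p r).
  exact/measurable_EFinP.
have Kp : (0 <= 2 `^ p :> R)%R by exact: powR_ge0.
have mKrho : measurable_fun [set: borel X]
    (fun x => (2 `^ p * mdist (x : X) xstar `^ p)%:E).
  by apply/measurable_EFinP; exact: measurable_funM.
have Krho0 (x : borel X) : 0 <= (2 `^ p * mdist (x : X) xstar `^ p)%:E.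
  by rewrite lee_fin mulr_ge0// powR_ge0.
have mdX := measurable_mdistX sepX p.
apply: le_trans (gc _ (fun x => (2 `^ p * mdist (x : X) xstar `^ p)%:E)
  (fun x => (2 `^ p * mdist (x : X) xstar `^ p)%:E) _ _ _ _ _ _ _) _ => //.
- exact/measurable_EFinP.
- by move=> z; rewrite lee_fin powR_ge0.
- by move=> z; rewrite -EFinD lee_fin; exact: mdist_powR_triangle.
have -> : (zeta^-1 * (eta + 2 `^ p * (2 * t + 4 * (r `^ p * s))) =
   zeta^-1 * eta + (2 `^ p * zeta^-1 * (t + r `^ p * (s + s))
   + 2 `^ p * zeta^-1 * (t + r `^ p * (s + s))))%R by ring.
rewrite 2!EFinD leeD//; [|rewrite leeD//].
- under eq_integral do rewrite -EFinM.
  apply: (@le_trans _ _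
      (\int[pi]_z (zeta^-1 * mdist (z.1 : X) (z.2 : X) `^ p)%:E)).
    apply: le_integral_EFin => //.
    + by apply: measurable_funM => //; exact: mdX.
    + by move=> z; apply: mulr_ge0; [exact: powR_ge0|exact: m0].
    + by apply: measurable_funM => //; exact: mdX.
    + move=> z; rewrite mulrC ler_wpM2r ?powR_ge0//.
      by rewrite ge_min az.
  rewrite integral_EFinZ ?(ltW zV)//; last by move=> z; exact: powR_ge0.
  by rewrite EFinM; apply: lee_wpmul2l; rewrite ?lee_fin ?(ltW zV).
- apply: (residual_cost (m := pi)
     (w := (fun z : borel X * borel X => mdist (z.1 : X) xstar `^ p)%R)
     (f := (fun z => a z.1 - m z)%R)
     (tau := fun z : borel X * borel X => tail_cost xstar p r z.1)
     (h := fun z : borel X * borel X => `|L z.1 - L z.2|%R)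
     (q := fun z : borel X * borel X => b z.2)) => //.
  + exact: (measurableT_comp mrho).
  + exact: measurable_funB.
  + exact: (measurableT_comp mtau).
  + by move=> z; exact: powR_ge0.
  + by move=> z; rewrite subr_ge0 /m ge_min lexx.
  + by move=> z; exact: tail_cost_ge0.
  + exact: ltW.
  + exact: powR_ge0.
  + by move=> z; exact: le_moment_tail_cost.
  + by move=> z; rewrite lerBlDr (le_trans (az _))// lerDl.
  + by move=> z; exact: residual_density_bound.
  + by rewrite [leLHS](integralT_image_measure measurable_fst cpi1 mtauE tau0E).
  + by rewrite bT.
- apply: (residual_cost (m := pi)
     (w := (fun z : borel X * borel X => mdist (z.2 : X) xstar `^ p)%R)
     (f := (fun z => b z.2 - m z)%R)
     (tau := fun z : borel X * borel X => tail_cost xstar p r z.2)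
     (h := fun z : borel X * borel X => `|L z.1 - L z.2|%R)
     (q := fun z : borel X * borel X => a z.1)) => //.
  + exact: (measurableT_comp mrho).
  + exact: measurable_funB.
  + exact: (measurableT_comp mtau).
  + by move=> z; exact: powR_ge0.
  + by move=> z; rewrite subr_ge0 /m ge_min lexx orbT.
  + by move=> z; exact: tail_cost_ge0.
  + exact: ltW.
  + exact: powR_ge0.
  + by move=> z; exact: le_moment_tail_cost.
  + by move=> z; rewrite lerBlDr (le_trans (bz _))// lerDl.
  + move=> z; rewrite /m minC distrC; apply: residual_density_bound => //.
    by rewrite distrC.
  + by rewrite [leLHS](integralT_image_measure measurable_snd cpi2 mtauE tau0E).
  + by rewrite aT.
Qed.

End posterior_coupling.

(** * Uniform continuity of the posterior map *)

Theorem proposition3p2 (R : realType) (X : completeMetricType R)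
    (sepX : separable X) (xstar : X)
    (p : R) (p1 : (1 <= p)%R)
    (L : X -> R) (L01 : forall x : X, (0 <= L x <= 1)%R)
    (ucL : unif_continuous_on_bounded xstar L)
    (C : set (probability (borel X) R)) (CP : C `<=` finite_moment xstar p)
    (tailC : moment_tail xstar p C r @[r --> +oo%R] --> 0)
    (zeta : R) (zeta0 : (0 < zeta)%R)
    (evC : zeta%:E <= ereal_inf [set evidence L mu | mu in C]) :
  (forall mu : probability (borel X) R,
     C mu -> finite_moment xstar p (posterior L mu)) /\
  (forall eps : R, (0 < eps)%R ->
     exists2 delta : R, (0 < delta)%R &
       forall mu nu : probability (borel X) R, C mu -> C nu ->
         wasserstein p mu nu < delta%:E ->
         wasserstein p (posterior L mu) (posterior L nu) < eps%:E).
Proof.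
have mL := measurable_likelihood ucL.
split.
  move=> mu Cmu; have [Z zZ ZE] := evidence_bounds L01 mL evC Cmu.
  apply: (finite_moment_posterior L01 mL _ ZE) => //; last exact: CP.
  exact: lt_le_trans zZ.
move=> eps eps0.
pose E : R := (eps `^ p)%R; have E0 : (0 < E)%R by exact: powR_gt0.
pose K : R := (2 `^ p)%R; have K0 : (0 < K)%R by exact: powR_gt0.
pose t := (zeta * E / (16 * K))%R.
have t0 : (0 < t)%R by rewrite divr_gt0 ?mulr_gt0.
have [r r1 tail_r] := tail_cost_small tailC t0.
have r0 : (0 < r)%R by lra.
pose M : R := (r `^ p)%R; have M0 : (0 < M)%R by exact: powR_gt0.
pose s := (zeta * E / (32 * K * M))%R.
have s0 : (0 < s)%R by rewrite divr_gt0 ?mulr_gt0.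
have [eta' eta'0 gap] := likelihood_gap sepX p1 L01 ucL tailC s0.
(* [t], [s] and [eta] make the three parts of the cost at most [E / 8], [E / 8]
   and [E / 4], for a total of at most [E / 2]. *)
pose eta := Num.min eta' (zeta * E / 4)%R.
have eta0 : (0 < eta)%R by rewrite lt_min eta'0 divr_gt0 ?mulr_gt0.
exists (eta `^ p^-1)%R; first exact: powR_gt0.
move=> mu nu Cmu Cnu /(coupling_of_wasserstein_lt p1 eta0)[pi cpi /ltW pieta].
have [Z zZ ZE] := evidence_bounds L01 mL evC Cmu.
have [Z' zZ' Z'E] := evidence_bounds L01 mL evC Cnu.
have piL : \int[pi]_z (`|L z.1 - L z.2|%R)%:E <= s%:E.
  apply: (gap mu nu) => //; apply: le_trans pieta _.
  by rewrite lee_fin ge_min lexx.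
have [g cg gcost] := posterior_coupling_cost sepX p1 L01 mL zeta0 zZ zZ'
  (ltW r0) ZE Z'E cpi pieta piL (tail_r _ Cmu) (tail_r _ Cnu).
apply: (wasserstein_lt_of_coupling p1 eps0 cg gcost).
rewrite -/K -/M -/E.
have -> : (zeta^-1 * (eta + K * (2 * t + 4 * (M * s))) =
    zeta^-1 * eta + E / 4)%R.
  by rewrite /t /s; field; rewrite !gt_eqF.
have : (zeta^-1 * eta <= E / 4)%R.
  by rewrite mulrC ler_pdivrMr// ge_min; apply/orP; right; lra.
lra.
Qed.
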